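(* The class $1\#$ is not closed under any of the following functional operations: minimum, maximum, proper subtraction, integer division, proper decrement, and integer division by two.
   Context: A one-way nondeterministic finite automaton (1nfa) is $M=(Q,\Sigma,\{\rhd,\lhd\},\delta,q_0,Q_{acc},Q_{rej})$: finite state set $Q$, input alphabet $\Sigma$, endmarkers $\rhd,\lhd\notin\Sigma$, disjoint sets $Q_{acc},Q_{rej}\subseteq Q$ ($Q_{halt}=Q_{acc}\cup Q_{rej}$), transition function $\delta:(Q-Q_{halt})\times(\Sigma\cup\{\rhd,\lhd\})\to\mathcal P(Q)$. On input $x$ it reads $\rhd x\lhd$ left to right, moving its head one cell right at every step (no $\lambda$-moves), halting on entering a halting state. $\#M(x)$ is the number of computation paths on $x$ that enter a state of $Q_{acc}$. A family $\{M_n\}_{n\in\mathbb N}$ has polynomial size if $|Q_n|\le p(n)$ for a fixed polynomial $p$. A family of partial functions over a fixed alphabet $\Sigma$ is $\{(f_n,D_n)\}_{n\in\mathbb N}$ with $f_n$ defined on $D_n\subseteq\Sigma^*$. $1\#$ is the class of such families for which some polynomial-size family of 1nfa's $\{M_n\}$ satisfies $f_n(x)=\#M_n(x)$ for all $n$ and $x\in D_n$. Operations on integers: integer division $a\oslash b=\lfloor a/b\rfloor$ for $b\ne0$; integer division by two is $a\oslash 2$; proper subtraction $a\ominus b=a-b$ if $a\ge b$ and $0$ otherwise; proper decrement is $a\ominus1$; minimum and maximum are $\min\{a,b\}$, $\max\{a,b\}$. For a binary operation $\circ$, a class is closed under $\circ$ if for any two families $\{(f_n,D_n)\}$, $\{(g_n,E_n)\}$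 in it, the family $\{(f_n\circ g_n,D_n\cap E_n)\}_n$, where $(f_n\circ g_n)(x)=f_n(x)\circ g_n(x)$, also belongs to it; for a unary operation $u$ (proper decrement, division by two), closure means $\{(u\circ f_n,D_n)\}_n$ belongs to it whenever $\{(f_n,D_n)\}$ does. *)

(* Defs.v *)
From mathcomp Require Import all_boot all_order all_algebra.

Set Implicit Arguments.
Unset Strict Implicit.
Unset Printing Implicit Defensive.

Inductive tape_symbol (Sigma : Type) : Type :=
  | LeftEnd
  | RightEnd
  | Letter of Sigma.

Arguments LeftEnd {Sigma}.
Arguments RightEnd {Sigma}.

Definition tape (Sigma : Type) (x : seq Sigma) : seq (tape_symbol Sigma) :=
  LeftEnd :: rcons (map (@Letter Sigma) x) RightEnd.

(* [nfa_delta] is total on states, but [is_computation] never consults it on a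
   halting state, so only its restriction to non-halting states matters. *)
Record nfa (Sigma : finType) : Type := Nfa {
  nfa_state : finType;
  nfa_start : nfa_state;
  nfa_acc : {set nfa_state};
  nfa_rej : {set nfa_state};
  nfa_delta : nfa_state -> tape_symbol Sigma -> {set nfa_state};
  nfa_acc_rej_disjoint : [disjoint nfa_acc & nfa_rej]
}.

Definition nfa_halt (Sigma : finType) (M : nfa Sigma) : {set nfa_state M} :=
  nfa_acc M :|: nfa_rej M.

(* [s] lists the states visited after [q] while reading a prefix of [w], one
   cell per step; no step leaves a halting state. *)
Fixpoint is_computation (Sigma : finType) (M : nfa Sigma) (q : nfa_state M)
    (w : seq (tape_symbol Sigma)) (s : seq (nfa_state M)) : bool :=
  match s, w with
  | [::], _ => true
  | _ :: _, [::] => false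
  | q' :: s', a :: w' =>
      [&& q \notin nfa_halt M, q' \in nfa_delta q a & is_computation q' w' s']
  end.

Definition is_accepting_path (Sigma : finType) (M : nfa Sigma)
    (x : seq Sigma) (s : seq (nfa_state M)) : bool :=
  is_computation (nfa_start M) (tape x) s
  && (last (nfa_start M) s \in nfa_acc M).

(* Accepting paths are counted by their number [k] of steps, which is at most
   the tape length. *)
Definition num_accepting (Sigma : finType) (M : nfa Sigma) (x : seq Sigma) : nat :=
  \sum_(k < (size (tape x)).+1)
    #|[set s : k.-tuple (nfa_state M) | is_accepting_path x s]|.

Definition polynomial_size (Sigma : finType) (M : nat -> nfa Sigma) : Prop :=
  exists p : {poly nat}, forall n : nat, #|nfa_state (M n)| <= p.[n]%R.

(* The values of [pf_fun F n] outside [pf_dom F n] are junk. *)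
Record pfun_family (Sigma : finType) : Type := PfunFamily {
  pf_fun : nat -> seq Sigma -> nat;
  pf_dom : nat -> seq Sigma -> Prop
}.

Definition one_sharp (Sigma : finType) (F : pfun_family Sigma) : Prop :=
  exists M : nat -> nfa Sigma,
    polynomial_size M /\
    forall (n : nat) (x : seq Sigma),
      pf_dom F n x -> pf_fun F n x = num_accepting (M n) x.

Definition unary_family (Sigma : finType) (u : nat -> nat)
    (F : pfun_family Sigma) : pfun_family Sigma :=
  PfunFamily (fun n x => u (pf_fun F n x)) (pf_dom F).

Definition binary_family (Sigma : finType) (op : nat -> nat -> nat)
    (F G : pfun_family Sigma) : pfun_family Sigma :=
  PfunFamily (fun n x => op (pf_fun F n x) (pf_fun G n x))
             (fun n x => pf_dom F n x /\ pf_dom G n x).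

Definition closed_unary (Sigma : finType) (u : nat -> nat) : Prop :=
  forall F : pfun_family Sigma, one_sharp F -> one_sharp (unary_family u F).

Definition closed_binary (Sigma : finType) (op : nat -> nat -> nat) : Prop :=
  forall F G : pfun_family Sigma,
    one_sharp F -> one_sharp G -> one_sharp (binary_family op F G).

(* Division by zero is undefined, so closure only concerns pairs whose divisor
   vanishes nowhere on the common domain.  Dropping instead the zeros of the
   divisor from the domain of the quotient gives an equivalent notion, since
   [one_sharp] is stable under shrinking domains. *)
Definition closed_division (Sigma : finType) : Prop :=
  forall F G : pfun_family Sigma,
    one_sharp F -> one_sharp G ->
    (forall (n : nat) (x : seq Sigma),
        pf_dom F n x -> pf_dom G n x -> pf_fun G n x <> 0) ->
    one_sharp (binary_family divn F G).

Definition proper_decrement (a : nat) : nat := a - 1.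

Definition division_by_two (a : nat) : nat := a %/ 2.

(* Main.v *)
(** A 1nfa with [O(n^2)] states that guesses an odd prime [p <= n] counts the
    number [f x] of odd primes [p <= n] dividing the length of [x].  If [g] is
    computed by a 1nfa with [m] states, the Hankel matrix of the values of [g]
    on powers of a letter has rank at most [m].  On the other hand the function
    [(1 - c) ^ f], with [c != 0], has a Hankel matrix of rank at least [2 ^ k],
    where [k] is the number of odd primes up to [n]: choosing positions by the
    Chinese remainder theorem with all residues in [{0, 1}] yields the [k]-th
    tensor power of the invertible matrix [[1 - c, 1], [1, 1]].  By Chebyshev's
    bound, [2 ^ k] is superpolynomial in [n].  Finally, [(1 - c) ^ f] is an
    affine combination of [f] and of the result of the operation: for [c = 1],
      [0 ^ f = 1 - min(f, 1) = max(f, 1) - f = (f (-) 1) - f + 1],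
    and for [c = 2], [(-1) ^ f = 4 (f %/ 2) - 2 f + 1]. *)
Require Import Defs.
From mathcomp Require Import all_boot all_order all_algebra.
From mathcomp Require Import zify ring.

Set Implicit Arguments.
Unset Strict Implicit.
Unset Printing Implicit Defensive.

Import GRing.Theory.

(** * Chebyshev's lower bound on the number of primes *)

Lemma expn2_le_central_bin (N : nat) : 2 ^ N <= 'C(N.*2, N).
Proof.
elim: N => [|N IHN] //.
rewrite doubleS expnS mul2n -addnn binS; apply: leq_add; apply: leq_trans IHN _.
  by rewrite binS leq_addl.
by case: (N) => // M; rewrite [X in _ <= X]binS leq_addr.
Qed.

(** By Legendre's formula the exponent is the sum over [k] of [N.*2 %/ p ^ k - 2 (N %/ p ^ k)]; each
    term is at most 1 and vanishes once [p ^ k > N.*2]. *)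
Lemma logn_central_bin (p N : nat) :
  prime p -> 0 < N -> logn p 'C(N.*2, N) <= trunc_log p N.*2.
Proof.
move=> pr_p N_gt0; have p_gt1 := prime_gt1 pr_p.
have leN : N <= N.*2 by rewrite -addnn leq_addr.
have := bin_fact leN; rewrite -{2}addnn addnK => /(congr1 (logn p)).
rewrite !lognM ?muln_gt0 ?fact_gt0 ?bin_gt0 // !logn_fact //.
have -> : \sum_(1 <= k < N.+1) N %/ p ^ k = \sum_(1 <= k < N.*2.+1) N %/ p ^ k.
  rewrite [RHS](big_cat_nat (n := N.+1)) //= [X in _ = _ + X]big_nat_cond.
  rewrite [X in _ = _ + X]big1 ?addn0 // => k /andP[/andP[ltNk _] _].
  by rewrite divn_small // (leq_trans ltNk) // ltnW // ltn_expl.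
set S2 := \sum_(_ <= _ < _) N.*2 %/ _; set S1 := \sum_(_ <= _ < _) _.
suff : S2 <= trunc_log p N.*2 + (S1 + S1) by lia.
have leL : (trunc_log p N.*2).+1 <= N.*2.+1.
  rewrite ltnS -(leq_exp2l _ _ p_gt1) (leq_trans (trunc_logP _ _)) //; first by lia.
  by rewrite ltnW // ltn_expl.
have -> : trunc_log p N.*2 = \sum_(1 <= k < N.*2.+1) (p ^ k <= N.*2).
  rewrite (big_cat_nat (n := (trunc_log p N.*2).+1)) //= [X in _ = _ + X]big_nat_cond.
  rewrite [X in _ = _ + X]big1 => [|k /andP[/andP[ltLk _] _]].
    rewrite addn0 big_nat_cond (eq_bigr (fun=> 1)) => [|k /andP[/andP[_ leLk] _]].
      by rewrite -big_nat_cond sum_nat_const_nat muln1 subn1.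
    rewrite (leq_trans _ (trunc_logP p_gt1 _)) ?leq_exp2l //; lia.
  apply/eqP; rewrite eqb0; apply: contraL ltLk => /(trunc_log_max p_gt1).
  by rewrite -leqNgt.
rewrite -!big_split; apply: leq_sum => k _ /=.
have d_gt0 : 0 < p ^ k by rewrite expn_gt0 prime_gt0.
case: (leqP (p ^ k) N.*2) => [_|lt]; last by rewrite divn_small.
rewrite -addnn divnD //; lia.
Qed.

(** The prime 2 is left out because positions will have residues 0 or 1 modulo [p], and [1 + 1] must
    not be divisible by [p]. *)
Definition odd_primes (n : nat) : seq nat :=
  [seq p <- index_iota 3 n.+1 | prime p].

Lemma odd_primesP (n p : nat) :
  (p \in odd_primes n) = [&& prime p, 2 < p & p <= n].
Proof. by rewrite mem_filter mem_index_iota ltnS. Qed.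

(** Every prime power in the factorization of the central binomial coefficient is at most [N.*2];
    the [.+1] in the exponent accounts for the prime 2. *)
Lemma chebyshev_lower_bound (N : nat) :
  0 < N -> 2 ^ N <= N.*2 ^ (size (odd_primes N.*2)).+1.
Proof.
move=> N_gt0; apply: leq_trans (expn2_le_central_bin N) _.
have leN : N <= N.*2 by rewrite -addnn leq_addr.
have C_gt0 : 0 < 'C(N.*2, N) by rewrite bin_gt0.
rewrite {1}(prod_prime_decomp C_gt0) prime_decompE big_map /=.
apply: leq_trans (_ : N.*2 ^ size (primes 'C(N.*2, N)) <= _).
  rewrite -count_predT -iter_muln_1 -big_const_seq big_seq.
  rewrite [X in _ <= X]big_seq; apply: leq_prod => p.
  rewrite mem_primes => /and3P[pr_p _ _].
  rewrite (leq_trans _ (trunc_logP (prime_gt1 pr_p) _)) //; last by lia.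
  by rewrite leq_exp2l ?prime_gt1 // logn_central_bin.
rewrite leq_exp2l; last by lia.
apply: (@uniq_leq_size _ _ (2 :: odd_primes N.*2)) (primes_uniq _) _ => p.
rewrite inE odd_primesP => p_C.
have pr_p : prime p by move: p_C; rewrite mem_primes => /and3P[].
have : 0 < trunc_log p N.*2.
  by rewrite (leq_trans _ (logn_central_bin pr_p N_gt0)) // logn_gt0.
by rewrite trunc_log_gt0 pr_p; case: eqP => //=; have := prime_gt1 pr_p; lia.
Qed.

Lemma horner_nat_le (p : {poly nat}) :
  exists K, forall n, p.[n]%R <= K * n.+1 ^ K.
Proof.
exists (\sum_(i < size p) (p`_i)%R + size p) => n.
rewrite horner_coef (@leq_trans (\sum_(i < size p) (p`_i)%R * n.+1 ^ size p)) //.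
  apply: leq_sum => i _; rewrite -[(_ * _)%R]/(_ * _) leq_mul2l natrXE.
  apply/orP; right; apply: (@leq_trans (n.+1 ^ i)); last first.
    by rewrite leq_pexp2l // ltnW.
  by case: (val i) => // e; rewrite leq_exp2r.
rewrite -big_distrl; apply: leq_mul; first exact: leq_addr.
by rewrite leq_pexp2l // leq_addl.
Qed.

Lemma exp2_odd_primes_superpolynomial (p : {poly nat}) :
  ~ forall n, 2 ^ size (odd_primes n) <= p.[n]%R.
Proof.
have [K leK] := horner_nat_le p => le_p.
(* At this [n] a polynomial bound leaves at most [K * (t + 3)] odd primes, so Chebyshev bounds
   [2 ^ t] by a quadratic in [t] with leading coefficient [K]. But [2 ^ t] is at least [u.+1 ^ 4],
   and [u] absorbs [K]. *)
pose u := 16 * K.+1; pose t := 4 * u; pose n := (2 ^ t).*2.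
have def_n : n = 2 ^ t.+1 by rewrite /n expnS mul2n.
have lt_exp k : k < 2 ^ k by apply: ltn_expl.
have : size (odd_primes n) <= K * (t + 3).
  rewrite -(@leq_exp2l 2) // (leq_trans (le_p n)) // (leq_trans (leK n)) //.
  apply: (@leq_trans (2 ^ K * (2 ^ t.+2) ^ K)).
    apply: leq_mul; first by apply: ltnW.
    have : n.+1 <= 2 ^ t.+2 by rewrite expnS -def_n; lia.
    by case: (K) => // K' le_n; rewrite leq_exp2r.
  by rewrite -expnM -expnD leq_exp2l //; lia.
have : 2 ^ t <= t.+1 * (size (odd_primes n)).+1.
  rewrite -(@leq_exp2l 2) // expnM -def_n; apply: chebyshev_lower_bound.
  by rewrite expn_gt0.
have : u.+1 ^ 4 <= 2 ^ t by rewrite /t mulnC expnM leq_exp2r.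
rewrite /t; have : 16 * K.+1 = u by [].
move: (size _) (2 ^ _) => m e; rewrite !expnS expn0; nia.
Qed.

(** * Invertible Hankel matrices of divisor counts *)

Lemma count_dvdn_mod (M x y : nat) (ps : seq nat) :
  all (dvdn^~ M) ps -> x = y %[mod M] ->
  count (dvdn^~ x) ps = count (dvdn^~ y) ps.
Proof.
move=> /allP dvd_M eq_xy; apply: eq_in_count => p /dvd_M p_M.
by rewrite /dvdn -(modn_dvdm x p_M) eq_xy modn_dvdm.
Qed.

(** By induction, each position chosen for [ps] gives two for [p :: ps], with residues 0 and 1
    modulo [p] and unchanged modulo the product of [ps]. *)
Lemma hankel_count_dvdn_unit (F : fieldType) (c : F) (ps : seq nat) :
  c != 0%R -> pairwise coprime ps -> all (ltn 2) ps ->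
  exists s : 'I_(2 ^ size ps) -> nat,
    (\matrix_(i, j) (1 - c) ^+ count (dvdn^~ (s i + s j)%N) ps)%R \in unitmx.
Proof.
move=> c_neq0; elim: ps => [|p ps IHps] /=.
  exists (fun=> 0) => /=; set B := (\matrix_(_, _) _)%R.
  suff -> : B = (1%:M)%R by rewrite unitmx1.
  by apply/matrixP=> i j; rewrite !mxE !ord1 expr0 eqxx.
move=> /andP[/allP co_p co_ps] /andP[p_gt2 ps_gt2].
have [s unitB] := IHps co_ps ps_gt2; set B := (\matrix_(_, _) _)%R in unitB.
pose M := \prod_(q <- ps) q.
have co_M : coprime M p.
  rewrite coprime_sym /M big_seq; elim/big_ind: _ => [|x y cx cy|q /co_p //].
    exact: coprimen1.
  by rewrite coprimeMr cx.
have ps_M : all (dvdn^~ M) ps.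
  by apply/allP => q q_ps; rewrite /M (big_rem q) //= dvdn_mulr.
rewrite expnS mul2n -addnn.
pose r (k : 'I_(2 ^ size ps + 2 ^ size ps)) : nat :=
  match split k with
  | inl i => chinese M p (s i) 0
  | inr i => chinese M p (s i) 1
  end.
have count_r a b i j :
    let k := chinese M p (s i) a + chinese M p (s j) b in
    (p %| k) + count (dvdn^~ k) ps =
    (p %| a + b) + count (dvdn^~ (s i + s j)) ps.
  rewrite /= (@count_dvdn_mod M _ (s i + s j)) //; last first.
    by rewrite -modnDm !chinese_modl // modnDm.
  by rewrite /dvdn -modnDm !chinese_modr // modnDm.
exists r.
set C := (\matrix_(_, _) _)%R.
(* [C] is the block matrix [[(1 - c) B, B], [B, B]]; subtracting the second
   block row from the first makes it lower triangular. *)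
have -> : C = (block_mx 1%:M 1%:M 0 1%:M *m block_mx (- c *: B) 0 B B)%R.
  rewrite mulmx_block !mul1mx !mul0mx !add0r.
  have -> : (- c *: B + B = (1 - c) *: B)%R by rewrite scalerBl scale1r scaleNr addrC.
  (* The four blocks have residue sums 0, 1, 1, 2 modulo [p > 2]; only the first is divisible by [p]
     and gains a factor [1 - c]. *)
  apply/matrixP=> k l; rewrite mxE /r.
  rewrite [RHS]mxE; case: (split k) => i; rewrite [RHS]mxE; case: (split l) => j;
    rewrite count_r !mxE ?add0n ?addn0 ?dvdn0 ?exprS ?dvdn1 //.
  - by rewrite (gtn_eqF (ltnW p_gt2)).
  - by rewrite (gtn_eqF (ltnW p_gt2)).
  - by rewrite gtnNdvd.
rewrite unitmx_mul unitmxE det_ublock !det1 mulr1 unitr1 /=.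
by rewrite unitmxE det_lblock unitrM -!unitmxE unitmxZ ?unitB // unitfE oppr_eq0.
Qed.

(** * Recursive path counts and the Hankel rank bound *)

Lemma sum_tuple_cons (T : finType) (k : nat) (F : k.+1.-tuple T -> nat) :
  \sum_(s : k.+1.-tuple T) F s =
  \sum_(x : T) \sum_(s : k.-tuple T) F [tuple of x :: s].
Proof.
rewrite pair_bigA (reindex (fun xs : T * k.-tuple T => [tuple of xs.1 :: xs.2])) //=.
exists (fun s => (thead s, [tuple of behead s])) => [[x s] _|s _].
  by congr (_, _); apply/val_inj.
by rewrite -tuple_eta.
Qed.

Section Runs.

Variables (Sigma : finType) (M : nfa Sigma).
Implicit Types (q : nfa_state M) (w : seq (tape_symbol Sigma)).

Fixpoint accepting_runs q w : nat :=
  if q \in nfa_halt M then nat_of_bool (q \in nfa_acc M)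
  else if w is a :: w' then \sum_(q' in nfa_delta q a) accepting_runs q' w' else 0.

Lemma accepting_runs_halt q w :
  q \in nfa_halt M -> accepting_runs q w = (q \in nfa_acc M).
Proof. by case: w => [|a w] /= ->. Qed.

(** From a halting state only the empty path survives; from any other state the empty path does not
    accept, and longer ones are sorted by their first step. *)
Lemma sum_computations q w :
  \sum_(k < (size w).+1) #|[set s : k.-tuple (nfa_state M) |
     is_computation q w s && (last q s \in nfa_acc M)]| = accepting_runs q w.
Proof.
have cardE k q1 w1 : #|[set s : k.-tuple (nfa_state M) |
     is_computation q1 w1 s && (last q1 s \in nfa_acc M)]| =
     \sum_(s : k.-tuple (nfa_state M))
       (is_computation q1 w1 s && (last q1 s \in nfa_acc M)).
  by rewrite -sum1_card big_mkcond; apply: eq_bigr => s _; rewrite inE; case: (_ && _).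
have card0 q1 w1 : #|[set s : 0.-tuple (nfa_state M) |
     is_computation q1 w1 s && (last q1 s \in nfa_acc M)]| = (q1 \in nfa_acc M).
  rewrite cardE (eq_bigr (fun=> nat_of_bool (q1 \in nfa_acc M))) => [|s _].
    by rewrite sum_nat_const card_tuple expn0 mul1n.
  by rewrite (tuple0 s) /=; case: w1.
have acc_halt q1 : q1 \notin nfa_halt M -> q1 \in nfa_acc M = false.
  by rewrite inE negb_or => /andP[/negPf].
elim: w q => [|a w IHw] q; rewrite big_ord_recl [X in X + _ = _]card0 [RHS]/=.
  by rewrite big_ord0 addn0; case: ifPn => // /acc_halt ->.
case: ifPn => [q_halt|q_run].
  rewrite big1 ?addn0 // => k _; rewrite cardE (@sum_tuple_cons _ k).
  rewrite big1 // => x _.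
  by rewrite big1 // => s _ /=; rewrite q_halt.
rewrite acc_halt // add0n.
under [RHS]eq_bigr do rewrite -IHw.
rewrite exchange_big; apply: eq_bigr => k _.
rewrite cardE (@sum_tuple_cons _ k) [RHS]big_mkcond; apply: eq_bigr => x _ /=.
case: ifP => x_q; last by rewrite big1 // => s _; rewrite andbF.
by rewrite cardE; apply: eq_bigr => s _; rewrite q_run.
Qed.

Lemma num_acceptingE (x : seq Sigma) :
  num_accepting M x = accepting_runs (nfa_start M) (tape x).
Proof. exact: sum_computations. Qed.

(** A run that halts inside [w] is kept in its halting state, so that early acceptance is counted by
    the factor of the suffix. *)
Fixpoint reaching_runs w q q' : nat :=
  if w is a :: w' then
    if q \in nfa_halt M then nat_of_bool (q == q')
    else \sum_(r in nfa_delta q a) reaching_runs w' r q'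
  else nat_of_bool (q == q').

Lemma accepting_runs_cat q u v :
  accepting_runs q (u ++ v) = \sum_q' reaching_runs u q q' * accepting_runs q' v.
Proof.
have sum_eq q1 : \sum_q' (q1 == q') * accepting_runs q' v = accepting_runs q1 v.
  rewrite (bigD1 q1) //= eqxx mul1n big1 ?addn0 // => q' /negPf neq.
  by rewrite eq_sym neq.
elim: u q => [|a u IHu] q /=; first by rewrite sum_eq.
case: ifP => q_halt; first by rewrite sum_eq accepting_runs_halt.
under eq_bigr do rewrite IHu.
by rewrite exchange_big /=; apply: eq_bigr => q' _; rewrite big_distrl.
Qed.

(* The Hankel matrix of [k |-> num_accepting M (a ^ k)] factors through the
   states of [M] in which a run can cross from the prefix to the suffix. *)
Lemma hankel_rank_le (F : fieldType) (a : Sigma) (h : nat -> nat) (d : nat)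
    (s : 'I_d -> nat) :
  (forall k, h k = num_accepting M (nseq k a)) ->
  \rank (\matrix_(i, j) ((h (s i + s j))%N%:R : F))%R <= #|nfa_state M|.
Proof.
move=> hE.
pose u k : seq (tape_symbol Sigma) := LeftEnd :: nseq k (Letter a).
pose v k : seq (tape_symbol Sigma) := rcons (nseq k (Letter a)) RightEnd.
set H := (\matrix_(_, _) _)%R.
have -> : H = ((\matrix_(i < d, k < #|nfa_state M|)
             (reaching_runs (u (s i)) (nfa_start M) (enum_val k))%:R) *m
          (\matrix_(k < #|nfa_state M|, j < d)
             (accepting_runs (enum_val k) (v (s j)))%:R))%R.
  apply/matrixP=> i j; rewrite !mxE hE num_acceptingE.
  have -> : tape (nseq (s i + s j) a) = u (s i) ++ v (s j).
    by rewrite /tape map_nseq nseqD rcons_cat.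
  rewrite accepting_runs_cat natr_sum (reindex (@enum_val _ (nfa_state M))) /=.
    by apply: eq_bigr => k _; rewrite !mxE natrM.
  exact: (onW_bij _ (enum_val_bij _)).
exact: mulmx_max_rank.
Qed.

End Runs.

(** * Automata for constants and for odd prime divisors of the length *)

Section Automata.

Variables (Sigma : finType).

(** The start state [None] branches on the left endmarker into [c] accepting states, one path
    each. *)
Definition constant_acc (c : nat) : {set option 'I_c} := [set~ None].

Lemma constant_disjoint (c : nat) :
  [disjoint constant_acc c & (set0 : {set option 'I_c})].
Proof. by rewrite -setI_eq0 setI0. Qed.

Definition constant_nfa (c : nat) : nfa Sigma :=
  @Nfa Sigma (option 'I_c) None (constant_acc c) set0
    (fun _ _ => constant_acc c) (constant_disjoint c).

Lemma num_accepting_constant (c : nat) (x : seq Sigma) :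
  num_accepting (constant_nfa c) x = c.
Proof.
rewrite num_acceptingE /= !inE /= (eq_bigr (fun=> 1)) => [|q q_acc].
  by rewrite sum1_card cardsC1 card_option card_ord.
by rewrite accepting_runs_halt ?inE ?orbF; move: q_acc; rewrite !inE => ->.
Qed.

Lemma one_sharp_constant (c : nat) :
  one_sharp (PfunFamily (fun (_ : nat) (_ : seq Sigma) => c) (fun _ _ => True)).
Proof.
exists (fun=> constant_nfa c); split=> [|n x _]; last by rewrite num_accepting_constant.
by exists (c.+1)%:P%R => n; rewrite hornerC card_option card_ord.
Qed.

Definition divisor_state (n : nat) : finType := option (option ('I_n.+1 * 'I_n.+1)).

(* [Some None] accepts; [Some (Some (p, r))] has guessed the prime [p] and read
   a number of letters congruent to [r] modulo [p]. *)
Definition divisor_delta (n : nat) (q : divisor_state n) (a : tape_symbol Sigma) :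
    {set divisor_state n} :=
  match q, a with
  | None, LeftEnd =>
      [set Some (Some (p, ord0)) | p : 'I_n.+1 & (p : nat) \in odd_primes n]
  | Some (Some (p, r)), Letter _ => [set Some (Some (p, inord (r.+1 %% p)))]
  | Some (Some (p, r)), RightEnd => if p %| r then [set Some None] else set0
  | _, _ => set0
  end.

Lemma divisor_disjoint (n : nat) :
  [disjoint ([set Some None] : {set divisor_state n}) & (set0 : {set divisor_state n})].
Proof. by rewrite -setI_eq0 setI0. Qed.

Definition divisor_nfa (n : nat) : nfa Sigma :=
  @Nfa Sigma (divisor_state n) None [set Some None] set0
    (@divisor_delta n) (divisor_disjoint n).

Lemma divisor_runs (n : nat) (p r : 'I_n.+1) (x : seq Sigma) :
  0 < p ->
  @accepting_runs _ (divisor_nfa n) (Some (Some (p, r)))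
     (rcons (map (@Letter Sigma) x) RightEnd) = (p %| r + size x).
Proof.
move=> p_gt0; elim: x r => [|y x IHx] r /=; rewrite !inE /=.
  rewrite addn0; case: ifP => _; last by rewrite big_set0.
  by rewrite big_set1 !inE.
(* The new residue is below [p], hence below [n.+1], so [inord] does not fall back to its
   default. *)
rewrite big_set1 IHx inordK; last by rewrite (leq_trans (ltn_pmod _ _)) // ltnW.
by rewrite /dvdn modnDml addSnnS.
Qed.

Lemma num_accepting_divisor (n : nat) (x : seq Sigma) :
  num_accepting (divisor_nfa n) x = count (dvdn^~ (size x)) (odd_primes n).
Proof.
rewrite num_acceptingE /= !inE /= big_imset => [|p p' _ _ [] //] /=.
rewrite -sum1_count [RHS]big_mkcond /= /odd_primes big_filter.
rewrite (eq_bigr (fun p : 'I_n.+1 => nat_of_bool (p %| size x))) => [|p]; last first.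
  by rewrite inE odd_primesP => /and3P[/prime_gt0 p_gt0 _ _]; rewrite divisor_runs.
rewrite (big_nat_widenl 3 0) // big_mkord; apply: eq_big => p.
  by rewrite inE odd_primesP -(ltnS p n) ltn_ord andbT.
by case: (_ %| _).
Qed.

Definition divisor_family : pfun_family Sigma :=
  PfunFamily (fun n x => count (dvdn^~ (size x)) (odd_primes n)) (fun _ _ => True).

Lemma card_divisor_state (n : nat) : #|divisor_state n| = (n.+1 * n.+1).+2.
Proof. by rewrite !card_option card_prod card_ord. Qed.

Lemma one_sharp_divisor : one_sharp divisor_family.
Proof.
exists divisor_nfa; split=> [|n x _]; last by rewrite num_accepting_divisor.
exists (('X + 1) ^+ 2 + 2%:P)%R => n.
rewrite card_divisor_state !hornerE /= !natrE; lia.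
Qed.

End Automata.

(** * From affine identities to non-closure *)

Lemma not_one_sharp_image (Sigma : finType) (u : nat -> nat) (c a b d : rat)
    (G : pfun_family Sigma) :
  0 < #|Sigma| -> c != 0%R ->
  (forall m, (1 - c) ^+ m = a * (u m)%:R + b * m%:R + d)%R ->
  (forall n x, pf_dom G n x) ->
  (forall n x, pf_fun G n x = u (count (dvdn^~ (size x)) (odd_primes n))) ->
  ~ one_sharp G.
Proof.
move=> /card_gt0P[y _] c_neq0 uE domG funG [M [[p le_p] MG]].
(* The summands bound the size of [M n], the [n.+1 ^ 2 + 2] states of the divisor automaton, and the
   rank 1 of the constant term. *)
apply: (@exp2_odd_primes_superpolynomial (p + ('X + 1) ^+ 2 + 3%:P)%R) => n.
have [||s unitC] := @hankel_count_dvdn_unit _ c (odd_primes n) c_neq0.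
- have : pairwise (fun p q => p != q) (odd_primes n).
    by rewrite -uniq_pairwise filter_uniq ?iota_uniq.
  apply: (@sub_in_pairwise _ (mem (odd_primes n))); last exact/allP.
  have odd_primes_prime q : q \in odd_primes n -> prime q.
    by rewrite odd_primesP => /andP[].
  move=> p1 p2 /odd_primes_prime pr1 /odd_primes_prime pr2 neq.
  by rewrite prime_coprime // dvdn_prime2.
- by apply/allP => q; rewrite odd_primesP => /and3P[].
pose f k := count (dvdn^~ k) (odd_primes n).
have rank_uf := @hankel_rank_le _ (M n) rat y (u \o f) _ s.
have rank_f := @hankel_rank_le _ (divisor_nfa Sigma n) rat y f _ s.
move: unitC; set C := (\matrix_(_, _) _)%R => unitC.
(* Writing the constant matrix as a column times a row shows that its rank is at most 1. *)
have CE : C = (a *: (\matrix_(i, j) ((u \o f) (s i + s j)%N)%:R)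
            + b *: (\matrix_(i, j) (f (s i + s j)%N)%:R)
            + const_mx d *m (const_mx 1 : 'rV_(_)))%R.
  by apply/matrixP => i j; rewrite !mxE uE big_ord1 !mxE mulr1.
apply: (@leq_trans (#|nfa_state (M n)| + #|divisor_state n| + 1)); last first.
  rewrite card_divisor_state !hornerE /= !natrE.
  by move: (le_p n); set e := (p.[n])%R; set m := #|nfa_state (M n)|; lia.
rewrite -(mxrank_unit unitC) CE.
apply: leq_trans (mxrank_add _ _) (leq_add _ (mulmx_max_rank _ _)).
apply: leq_trans (mxrank_add _ _) (leq_add _ _); apply: leq_trans (mxrank_scale _ _) _.
  by apply: rank_uf => k; rewrite -MG // funG size_nseq.
by apply: rank_f => k; rewrite num_accepting_divisor size_nseq.
Qed.

Theorem theorem6p1 (Sigma : finType) (Sigma_nonempty : 0 < #|Sigma|) :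
  ~ closed_binary Sigma minn /\
  ~ closed_binary Sigma maxn /\
  ~ closed_binary Sigma subn /\
  ~ closed_division Sigma /\
  ~ closed_unary Sigma proper_decrement /\
  ~ closed_unary Sigma division_by_two.
Proof.
have sharp_f := one_sharp_divisor Sigma.
have sharp_c := one_sharp_constant Sigma.
(* At [m = 0] both sides are 1, since [0 ^ 0 = 1] and [0 - 1] truncates to 0. *)
have decE m : ((1 - 1) ^+ m = 1 * (m - 1)%N%:R + (-1) * m%:R + 1 :> rat)%R.
  case: m => [|m]; first by rewrite expr0 sub0n; ring.
  by rewrite subrr expr0n subn1 /= -[in RHS]natr1; ring.
(* Since [m - 2 (m %/ 2)] is the parity bit of [m], the right side is 1 minus twice that bit. *)
have halfE m : ((1 - 2) ^+ m = 4 * (m %/ 2)%:R + (-2) * m%:R + 1 :> rat)%R.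
  have -> : (m%:R = (m %/ 2)%:R * 2 + (odd m)%:R :> rat)%R.
    by rewrite {1}(divn_eq m 2) modn2 natrD natrM.
  have -> : (1 - 2 = -1 :> rat)%R by [].
  by rewrite -signr_odd; case: (odd m); rewrite /= ?expr0 ?expr1; ring.
(* Each binary operation becomes unary by fixing its second argument to a constant: 1, or 2 for
   division. *)
split=> [cl|].
  apply: (@not_one_sharp_image Sigma (fun m => minn m 1) 1 (-1) 0 1)
    (cl _ _ sharp_f (sharp_c 1)) => //.
  by case=> [|m]; rewrite ?expr0 ?minn0 ?min0n ?subrr ?expr0n ?minnSS ?minn0 /=; ring.
split=> [cl|].
  apply: (@not_one_sharp_image Sigma (fun m => maxn m 1) 1 1 (-1) 0)
    (cl _ _ sharp_f (sharp_c 1)) => //.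
  by case=> [|m]; rewrite ?expr0 ?max0n ?subrr ?expr0n ?maxnSS ?maxn0 /=; ring.
split=> [cl|].
  by apply: (@not_one_sharp_image Sigma (fun m => m - 1) 1 1 (-1) 1)
    (cl _ _ sharp_f (sharp_c 1)).
split=> [cl|].
  by apply: (@not_one_sharp_image Sigma (fun m => m %/ 2) 2 4 (-2) 1)
    (cl _ _ sharp_f (sharp_c 2) _).
split=> cl.
  by apply: (@not_one_sharp_image Sigma (fun m => m - 1) 1 1 (-1) 1)
    (cl _ sharp_f).
by apply: (@not_one_sharp_image Sigma (fun m => m %/ 2) 2 4 (-2) 1)
    (cl _ sharp_f).
Qed.
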